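(* Let $\boldsymbol\theta=(\theta_i)_{i\ge1}$ be a sequence of strictly positive reals with $\theta_1=1$, let $p_1=0$, $p_2=1$ and $p_i=\frac{i-1}{i-1+\theta_i}$ for $i\ge3$, and let $\mathcal{A}_j(n)$ be the length of the $j$-th cycle, in order of formation, of the random derangement process $X^{n,\mathbf{p}}$ (with $\mathcal{A}_j(n)=0$ if there are fewer than $j$ cycles). Suppose $\theta_n\to\theta$ as $n\to\infty$, where $\theta>0$. Then $$n^{-1}(\mathcal{A}_1(n),\mathcal{A}_2(n),\dots)\Rightarrow(\mathcal{A}_1,\mathcal{A}_2,\dots)\quad\text{as }n\to\infty,$$ where $(\mathcal{A}_1,\mathcal{A}_2,\dots)$ has the $\mathrm{GEM}(\theta)$ distribution and $\Rightarrow$ denotes convergence in distribution (equivalently, of all finite-dimensional distributions).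
   Context: Random derangement process: put $q_i=1-p_i$. For $n\ge 2$, $X^{n,\mathbf{p}}=(X_{n+1}=1,X_n,\dots,X_1)$ is the $\{0,1\}$-valued inhomogeneous Markov chain, run in decreasing index and started from $X_{n+1}=1$, such that $X_n=0$ a.s., $X_1=1$ a.s., and for $2\le r\le n-1$: $\mathbb{P}(X_r=0\mid X_{r+1}=0)=p_r$, $\mathbb{P}(X_r=1\mid X_{r+1}=0)=q_r$, $\mathbb{P}(X_r=0\mid X_{r+1}=1)=1$. Let $K_n=\sum_{i=1}^nX_i$. If $n+1=i_0>i_1>\dots>i_{K_n}=1$ are the positions of the $1$s in $(X_{n+1},X_n,\dots,X_1)$, the length of the $j$-th cycle is $\mathcal{A}_j(n)=i_{j-1}-i_j$ for $1\le j\le K_n$, and $\mathcal{A}_j(n)=0$ for $j>K_n$. $\mathrm{GEM}(\theta)$ is the law of $(W_1,(1-W_1)W_2,(1-W_1)(1-W_2)W_3,\dots)$ with $W_i$ i.i.d. $\mathrm{Beta}(1,\theta)$; its first $r$ coordinates have density $\frac{\theta^r(1-x_1-\cdots-x_r)^{\theta-1}}{(1-x_1)(1-x_1-x_2)\cdots(1-x_1-\cdots-x_{r-1})}$ on $x_1,\dots,x_r>0$, $x_1+\cdots+x_r<1$. *)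

(* Defs.v *)
(* MathComp / MathComp-Analysis development. *)
From HB Require Import structures.
From mathcomp Require Import all_boot all_order all_algebra.
From mathcomp Require Import all_classical all_reals all_analysis.

Set Implicit Arguments.
Unset Strict Implicit.
Unset Printing Implicit Defensive.

Import Order.TTheory GRing.Theory Num.Theory.
Import numFieldNormedType.Exports.

Local Open Scope classical_set_scope.
Local Open Scope ring_scope.

(* 0 by convention when P B = 0; below, the conditioning events always have
   positive probability (in derangement_markov, P (past) != 0 also implies
   that the event on X_{r+1} is not null). *)
Definition cond_prob d (T : measurableType d) (R : realType)
    (P : probability T R) (A B : set T) : R :=
  fine (P (A `&` B)) / fine (P B).

Section derangement_process.
Context d (T : measurableType d) (R : realType) (P : probability T R).

(* The values 0 and 1 are encoded by false and true. *)
Definition state_event (X : nat -> {RV P >-> bool}) (r : nat) (b : bool) :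
  set T := [set w | X r w = b].

(* The chain runs in decreasing index, so the past of X_r is
   (X_{n+1}, ..., X_{r+1}). *)
Definition past_event (X : nat -> {RV P >-> bool}) (n r : nat)
    (x : nat -> bool) : set T :=
  [set w | forall k, (r < k <= n.+1)%N -> X k w = x k].

(* Only X_1, ..., X_{n+1} are constrained; the other X_k play no role. *)
Record derangement_process (p : nat -> R) (n : nat)
    (X : nat -> {RV P >-> bool}) : Prop := {
  derangement_start : {ae P, forall w, X n.+1 w = true} ;
  derangement_first : {ae P, forall w, X n w = false} ;
  derangement_last : {ae P, forall w, X 1 w = true} ;
  derangement_markov : forall (r : nat) (x : nat -> bool),
    (1 <= r <= n)%N -> P (past_event X n r x) != 0%E ->
    cond_prob P (state_event X r (x r)) (past_event X n r x) =
    cond_prob P (state_event X r (x r)) (state_event X r.+1 (x r.+1)) ;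
  derangement_after0 : forall r : nat, (2 <= r <= n.-1)%N ->
    P (state_event X r.+1 false) != 0%E ->
    cond_prob P (state_event X r false) (state_event X r.+1 false) = p r /\
    cond_prob P (state_event X r true) (state_event X r.+1 false) = 1 - p r ;
  derangement_after1 : forall r : nat, (2 <= r <= n.-1)%N ->
    P (state_event X r.+1 true) != 0%E ->
    cond_prob P (state_event X r false) (state_event X r.+1 true) = 1
}.

End derangement_process.

Definition cycle_count (n : nat) (x : nat -> bool) : nat :=
  (\sum_(1 <= i < n.+1) x i)%N.

(* i_0 > i_1 > ... : the positions of the ones in (x_{n+1}, x_n, ..., x_1) *)
Definition one_positions (n : nat) (x : nat -> bool) : seq nat :=
  [seq i <- rev (iota 1 n.+1) | x i].

Definition cycle_length (n : nat) (x : nat -> bool) (j : nat) : nat :=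
  if (1 <= j <= cycle_count n x)%N
  then (nth 0 (one_positions n x) j.-1 - nth 0 (one_positions n x) j)%N
  else 0%N.

(* Sequences (a_1, a_2, ...) are encoded as functions on nat, with a_{j+1} at
   index j. *)
Definition scaled_cycle_lengths (R : realType) (n : nat) (x : nat -> bool) :
  {ptws nat -> R} := fun j => n%:R^-1 * (cycle_length n x j.+1)%:R.

Definition mutually_independent d (T : measurableType d) (R : realType)
    (P : probability T R) (W : nat -> {RV P >-> R}) : Prop :=
  forall (s : seq nat) (B : nat -> set R), uniq s ->
    (forall i, measurable (B i)) ->
    P (\bigcap_(i in [set` s]) (W i @^-1` B i)) =
    (\prod_(i <- s) P (W i @^-1` B i))%E.

(* The library's beta distribution only has natural number parameters. *)
Definition real_beta_fun (R : realType) (a b : R) : R :=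
  \int[lebesgue_measure]_(x in `]0, 1[) (x `^ (a - 1) * (1 - x) `^ (b - 1)).

Definition real_beta_pdf (R : realType) (a b x : R) : R :=
  if 0 < x < 1 then x `^ (a - 1) * (1 - x) `^ (b - 1) / real_beta_fun a b
  else 0.

Definition beta_distributed d (T : measurableType d) (R : realType)
    (P : probability T R) (a b : R) (W : {RV P >-> R}) : Prop :=
  forall B : set R, measurable B ->
    distribution P W B =
    (\int[lebesgue_measure]_(x in B) (real_beta_pdf a b x)%:E)%E.

Definition stick_breaking (R : realType) (w : nat -> R) : {ptws nat -> R} :=
  fun j => (\prod_(i < j) (1 - w i)) * w j.

Definition product_sigma_algebra (R : realType) : set (set (nat -> R)) :=
  <<s [set C | exists (i : nat) (B : set R),
         measurable B /\ C = [set x | B (x i)]] >>.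

(* The law of A on the product sigma-algebra is that of a stick-breaking
   sequence, which may live on another probability space. *)
Definition GEM_distributed d (T : measurableType d) (R : realType)
    (P : probability T R) (theta : R) (A : nat -> {RV P >-> R}) : Prop :=
  exists (d' : measure_display) (T' : measurableType d')
    (P' : probability T' R) (W : nat -> {RV P' >-> R}),
    [/\ mutually_independent W,
        forall i, beta_distributed 1 theta (W i) &
        forall E : set (nat -> R), product_sigma_algebra E ->
          P [set w | E (fun j => A j w)] =
          P' [set w | E (stick_breaking (fun i => W i w))]].

(* Weak convergence of the laws on the space of real sequences, with the
   product topology; Y_n may live on a space depending on n. *)
Definition converges_in_distribution (R : realType)
    (d : nat -> measure_display) (T : forall n, measurableType (d n))
    (P : forall n, probability (T n) R) (Y : forall n, T n -> {ptws nat -> R})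
    (d' : measure_display) (T' : measurableType d') (Q : probability T' R)
    (Z : T' -> {ptws nat -> R}) : Prop :=
  forall f : {ptws nat -> R} -> R, continuous f ->
    (exists M : R, forall x, `|f x| <= M) ->
    ('E_(P n)[fun w => f (Y n w)])%E @[n --> \oo] --> ('E_Q[fun w => f (Z w)])%E.

(* Main.v *)
Require Import Defs.
From HB Require Import structures.
From mathcomp Require Import all_boot all_order all_algebra.
From mathcomp Require Import all_classical all_reals all_analysis.
From mathcomp Require Import measurable_realfun ring lra zify.

Set Implicit Arguments.
Unset Strict Implicit.
Unset Printing Implicit Defensive.

Import Order.TTheory GRing.Theory Num.Theory.
Import numFieldNormedType.Exports.

Local Open Scope classical_set_scope.
Local Open Scope ring_scope.

(** The positions of the ones form a Markov chain: a one at i is followed by its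
    next one at a position at most m with probability the product of the p_k for
    m < k < i - 1, which behaves like (m / i)^theta. On the other hand, if W is
    Beta(1, theta), then (1 - W)^theta is uniform. Reading the successive
    positions off the quantile functions of the chain at the uniforms
    (1 - W_j)^theta therefore realises the cycle lengths of all the processes
    X^n on the single probability space of the stick-breaking sequence W. There,
    the quantile asymptotics (next position from i at level v) / i -> v^(1/theta)
    give almost sure convergence of the j-th position over n to the product of
    the first j factors 1 - W_i, and dominated convergence concludes. *)

(** * The chain of positions of the ones *)

(* Probability that the first one below a one at i is at a position <= m. The
   product stops before i - 1, because X_{i-1} = 0 after X_i = 1. *)
Definition next_cdf (R : realType) (p : nat -> R) (i m : nat) : R :=
  if m is 0 then 0 else \prod_(m.+1 <= k < i.-1) p k.

(* The quantile function of [next_cdf p i]: the least m with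
   v <= next_cdf p i m, see [next_one_le]. It fixes i = 1. *)
Definition next_one (R : realType) (p : nat -> R) (i : nat) (v : R) : nat :=
  (\sum_(1 <= m < i) (next_cdf p i m < v)%R)%N.+1.

Lemma sum_bool_le (c : nat -> bool) a m k : (k - a <= m)%N ->
  (\sum_(a <= i < k) c i <= m)%N.
Proof.
apply: leq_trans; rewrite -[leqRHS]muln1 -sum_nat_const_nat.
by apply: leq_sum => i _; case: (c i).
Qed.

Section next_one_theory.
Context (R : realType) (p : nat -> R).
Hypothesis p01 : forall k, (2 <= k)%N -> 0 < p k <= 1.

Let prod01 a b : (1 <= a)%N -> 0 < \prod_(a.+1 <= k < b) p k <= 1.
Proof.
move=> a1; rewrite big_nat_cond; elim/big_ind : _ => [|x y|k].
- by rewrite ltr01 lexx.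
- move=> /andP[x0 x1] /andP[y0 y1]; rewrite mulr_gt0//=.
  by rewrite mulr_ile1// ltW.
- by rewrite andbT => /andP[ak _]; apply: p01; lia.
Qed.

Lemma next_cdf_gt0 i m : (0 < m)%N -> 0 < next_cdf p i m.
Proof. by case: m => // m _; have /andP[] := prod01 i.-1 (ltn0Sn m). Qed.

Lemma next_cdf_ge0 i m : 0 <= next_cdf p i m.
Proof. by case: m => // m; rewrite ltW// next_cdf_gt0. Qed.

Lemma next_cdf_le1 i m : next_cdf p i m <= 1.
Proof. by case: m => // m; have /andP[] := prod01 i.-1 (ltn0Sn m). Qed.

(** Empty product: a one at [i >= 3] is followed by a zero, so its gap is at least 2. *)
Lemma next_cdf_tail i m : (0 < m)%N -> (i <= m.+2)%N -> next_cdf p i m = 1.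
Proof. by case: m => // m _ im; rewrite /next_cdf big_geq//; lia. Qed.

(** Passing below [m] costs one further zero, of probability [p m]. *)
Lemma next_cdf_pred i m : (2 <= m)%N -> (m.+2 <= i)%N ->
  next_cdf p i m.-1 = p m * next_cdf p i m.
Proof. by case: m => [//|[//|m]] _ mi; rewrite /next_cdf/= big_ltn//; lia. Qed.

Lemma next_cdf_homo i : {homo next_cdf p i : m l / (m <= l)%N >-> m <= l}.
Proof.
apply: homo_leq => [//|x y z|m]; first exact: le_trans.
case: m => [|m]; first exact: next_cdf_ge0.
have [mi|im] := leqP m.+4 i; last first.
  by rewrite !next_cdf_tail//; lia.
rewrite -[X in next_cdf p i X <= _]/(m.+2.-1) next_cdf_pred//.
have /andP[_ pm1] := @p01 m.+2 isT.
by rewrite ler_piMl// next_cdf_ge0.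
Qed.

(** By monotonicity the indices [k] with [next_cdf p i k < v] form an initial segment, so counting
    them finds the first index at which the level [v] is reached. *)
Lemma next_one_le i m (v : R) : 0 < v <= 1 -> (0 < i)%N ->
  (next_one p i v <= m)%N = (v <= next_cdf p i m).
Proof.
move=> /andP[v0 v1] i0.
(* At 0 both sides fail: [next_one] is a successor and [next_cdf p i 0 = 0 < v]. *)
case: m => [|m]; first by rewrite leNgt v0.
rewrite ltnS; have [vG|Gv] := leP v (next_cdf p i m.+1).
  have [mi|im] := ltnP m.+1 i; last first.
    by apply: sum_bool_le; lia.
  rewrite (@big_cat_nat _ _ _ m.+1)//=; last exact: ltnW.
  rewrite [X in (_ + X)%N]big_nat_cond [X in (_ + X)%N]big1 ?addn0.
    by apply: sum_bool_le; lia.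
  move=> k; rewrite andbT => /andP[mk _].
  by rewrite ltNge (le_trans vG)// next_cdf_homo.
(* Otherwise [next_cdf_tail] gives the value 1, which cannot be below [v <= 1]. *)
have mi : (m.+1 < i)%N.
  rewrite ltnNge; apply: contraTN Gv => im.
  by rewrite -leNgt next_cdf_tail//; lia.
apply/negbTE; rewrite -ltnNge (@big_cat_nat _ _ _ m.+2)//=.
apply: (leq_trans _ (leq_addr _ _)).
rewrite big_nat_cond (eq_bigr (fun=> 1%N)); last first.
  move=> k; rewrite andbT => /andP[_ km].
  by rewrite (le_lt_trans _ Gv)// next_cdf_homo.
by rewrite -big_nat_cond sum_nat_const_nat; lia.
Qed.

Lemma next_one1 (v : R) : next_one p 1 v = 1%N.
Proof. by rewrite /next_one big_geq. Qed.

(* Also correct for m = 1, since [next_cdf p i 0 = 0 < v]. *)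
Lemma next_one_eq i m (v : R) : 0 < v <= 1 -> (0 < i)%N -> (0 < m)%N ->
  (next_one p i v == m) = (next_cdf p i m.-1 < v <= next_cdf p i m).
Proof.
move=> v01 i0 m0; rewrite ltNge -!next_one_le//; lia.
Qed.

End next_one_theory.

(* The step to X_1 is overridden, as [X_1 = 1] almost surely. *)
Definition transition (R : realType) (p : nat -> R) (k : nat) (b b' : bool) : R :=
  if (k == 1)%N then b'%:R else
  if b then (~~ b')%:R else if b' then 1 - p k else p k.

(** Listed downwards from [n.+1], so that lowering [r] follows the run of the chain and only
    appends; [r = 0] gives the full list. *)
Definition ones_from (n r : nat) (x : nat -> bool) : seq nat :=
  [seq i <- rev (iota r.+1 (n.+1 - r)) | x i].

(** The probability that the chain of positions follows [s]: each factor is the mass at the next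
    position of the law with distribution function [next_cdf]. *)
Definition path_weight (R : realType) (p : nat -> R) (s : seq nat) : R :=
  \prod_(0 <= j < (size s).-1)
    (next_cdf p (nth 1%N s j) (nth 1%N s j.+1) -
     next_cdf p (nth 1%N s j) (nth 1%N s j.+1).-1).

(** * Trajectory probabilities as weights of lists of ones *)

Section path_weight_theory.
Context (R : realType) (p : nat -> R).

Lemma path_weight_rcons (s : seq nat) m : s != [::] ->
  path_weight p (rcons s m) = path_weight p s *
    (next_cdf p (last 1%N s) m - next_cdf p (last 1%N s) m.-1).
Proof.
case: s => // a s _; rewrite /path_weight /= size_rcons big_nat_recr//=.
rewrite -rcons_cons !nth_rcons /= ltnn eqxx ltnSn (last_nth 1%N).
congr (_ * _); apply: eq_big_nat => j /andP[_ js].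
by rewrite -rcons_cons !nth_rcons/= ltnS js (ltnW js).
Qed.

Lemma ones_from_pred n r (x : nat -> bool) : (0 < r <= n)%N ->
  ones_from n r.-1 x =
  if x r then rcons (ones_from n r x) r else ones_from n r x.
Proof.
move=> /andP[r0 rn]; rewrite /ones_from prednK//.
rewrite (_ : (n.+1 - r.-1 = (n.+1 - r).+1)%N)/=; last by lia.
by rewrite rev_cons filter_rcons.
Qed.

(** Reads the current state of the chain of bits off the list, which links the two chains. *)
Lemma last_ones_from n r (x : nat -> bool) : (r <= n)%N -> x n.+1 ->
  [/\ ones_from n r x != [::], (r < last 1%N (ones_from n r x))%N &
   x r.+1 = (last 1%N (ones_from n r x) == r.+1)].
Proof.
move=> rn xn; elim: {r}(n - r)%N {-2}r (erefl (n - r)%N) rn => [|k IH] r kr rn.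
  have -> : r = n by lia.
  by rewrite /ones_from subSnn/= xn/= ltnSn eqxx.
have r1 : (r.+1 <= n)%N by lia.
have [s0 rl xr] := IH r.+1 ltac:(lia) r1.
have := @ones_from_pred n r.+1 x r1; rewrite /= => ->.
case: ifP => xr1.
  by rewrite last_rcons ltnSn eqxx; split=> //; case: (ones_from _ _ _).
by split=> //; [lia|apply/esym/negbTE; rewrite neq_ltn rl orbT].
Qed.

(** Invariant of the run down to [r.+1]: closed gaps contribute [path_weight], and the gap still
    open below the last one contributes the probability that the next one is at [r] or lower. *)
Lemma prod_transition_from n r (x : nat -> bool) : (0 < r <= n)%N -> x n.+1 ->
  \prod_(r.+1 <= k < n.+1) transition p k (x k.+1) (x k) =
  path_weight p (ones_from n r x) * next_cdf p (last 1%N (ones_from n r x)) r.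
Proof.
move=> /andP[r0 rn] xn.
elim: {r}(n - r)%N {-2}r (erefl (n - r)%N) r0 rn => [|k IH] r kr r0 rn.
  have -> : r = n by lia.
  rewrite big_geq// /ones_from subSnn/= xn /path_weight big_geq//=.
  by rewrite mul1r next_cdf_tail//; lia.
have r1 : (r.+1 <= n)%N by lia.
have [s0 rl xr] := last_ones_from r1 xn.
have := @ones_from_pred n r.+1 x r1; rewrite /= => ->.
rewrite big_ltn// (IH r.+1)//; last by lia.
set s := ones_from n r.+1 x in s0 rl xr *.
rewrite mulrCA /transition eqSS gtn_eqF// xr.
(* A zero keeps the gap open and multiplies its probability by [p r.+1], except right after a one,
   where the zero is certain and both values of [next_cdf] are 1. *)
case xr1 : (x r.+1); last first.
  congr (_ * _); have [le|le] := eqVneq (last 1%N s) r.+2.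
    by rewrite le mul1r !next_cdf_tail.
  by rewrite -(@next_cdf_pred _ _ _ r.+1)//; lia.
(* A one closes the gap: the factor [1 - p r.+1] turns the open probability into an increment of
   [next_cdf], and the new open gap has probability 1. *)
rewrite path_weight_rcons// last_rcons (@next_cdf_tail _ _ _ r)// mulr1.
congr (_ * _).
have [le|le] := eqVneq (last 1%N s) r.+2.
  by rewrite le !next_cdf_tail// mul0r subrr.
by rewrite mulrBl mul1r -(@next_cdf_pred _ _ _ r.+1)//; lia.
Qed.

(** The forced one at 1 closes the last gap. Its open probability is already the increment at 1,
    because [next_cdf] is 0 at 0. *)
Lemma prod_transition n (x : nat -> bool) : (0 < n)%N -> x n.+1 -> x 1%N ->
  \prod_(1 <= k < n.+1) transition p k (x k.+1) (x k) =
  path_weight p (ones_from n 0 x).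
Proof.
move=> n0 xn x1.
have [s0 rl xr] := @last_ones_from n 1 x n0 xn.
rewrite big_ltn// prod_transition_from//.
rewrite {1}/transition eqxx x1 mul1r.
have := @ones_from_pred n 1 x n0; rewrite /= x1 => ->.
by rewrite path_weight_rcons//= subr0.
Qed.

End path_weight_theory.

(** * Asymptotics of the quantile functions *)

Lemma cvg_succE (R : realType) (u : nat -> R) (l : R) :
  u n.+1 @[n --> \oo] --> l <-> u n @[n --> \oo] --> l.
Proof. by rewrite -(cvg_shiftS u). Qed.

Lemma ln_le_subr1 (R : realType) (x : R) : 0 < x -> ln x <= x - 1.
Proof.
move=> x0; rewrite -[X in ln X](subrK 1) [X in ln X]addrC le_ln1Dx//.
by rewrite ltrBrDr addNr.
Qed.

Section next_one_asymptotics.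
Context (R : realType) (theta p : nat -> R) (th : R).
Hypotheses (theta0 : forall i, (1 <= i)%N -> 0 < theta i) (th0 : 0 < th).
Hypotheses (p2 : p 2%N = 1) (pE : forall i, (3 <= i)%N ->
  p i = (i%:R - 1) / (i%:R - 1 + theta i)).
Hypothesis theta_th : theta n @[n --> \oo] --> th.

Lemma stay_prob_bounds k : (2 <= k)%N -> 0 < p k <= 1.
Proof.
case: k => [//|[//|[_|k _]]]; first by rewrite p2 ltr01 lexx.
rewrite pE//; have t0 := @theta0 k.+3 isT.
have k0 : (0 : R) < k.+3%:R - 1 by rewrite subr_gt0 ltr1n.
apply/andP; split; first by rewrite divr_gt0// addr_gt0.
rewrite ler_pdivrMr ?(addr_gt0 k0)//.
by rewrite mul1r lerDl ltW.
Qed.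

Let logstep (j : nat) : R := ln (j.+1%:R / j%:R).

Let inv_nat_cvg0 : (j%:R^-1 : R) @[j --> \oo] --> 0.
Proof. by apply/cvg_succE; exact: cvg_harmonic. Qed.

(** Both bounds come from ln(1 + x) <= x, at x = -1/(j+1) and at x = 1/j. *)
Let logstep_bounds j : (1 <= j)%N -> (j.+1%:R^-1 : R) <= logstep j <= j%:R^-1.
Proof.
move=> j1; have j0 : (0 : R) < j%:R by rewrite ltr0n.
have j10 : (0 : R) < j.+1%:R by rewrite ltr0n.
apply/andP; split.
  rewrite /logstep -[X in ln X]invrK lnV ?posrE ?invr_gt0 ?divr_gt0// invf_div.
  have -> : (j%:R / j.+1%:R : R) = 1 + - j.+1%:R^-1.
    by rewrite -natr1 -[X in X - _](@divff _ j.+1%:R) ?gt_eqF//; field; lra.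
  rewrite lerNr le_ln1Dx// ltrN2 invf_lt1// ltr1n; lia.
have -> : logstep j = ln (1 + j%:R^-1).
  by rewrite /logstep -natr1 mulrDl divff ?gt_eqF// mul1r.
by rewrite le_ln1Dx// (lt_trans (ltrN10 _))// invr_gt0.
Qed.

(** Since [p j.+1] is j/(j + theta), its -ln lies between 1 - p = theta p/j and theta/j. Then
    [logstep_bounds] replaces 1/j by [logstep j]; the upper bound pays the factor 1 + 1/j, as 1/j =
    (1 + 1/j)/(j+1). *)
Let ln_stay_bounds j : (2 <= j)%N ->
  theta j.+1 * p j.+1 * logstep j <= - ln (p j.+1) <=
  theta j.+1 * (1 + j%:R^-1) * logstep j /\ - ln (p j.+1) <= theta j.+1 * j%:R^-1.
Proof.
move=> j2; have j0 : (0 : R) < j%:R by rewrite ltr0n; lia.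
have /andP[l1 l2] := @logstep_bounds j ltac:(lia).
have t0 := @theta0 j.+1 isT.
have pj : p j.+1 = j%:R / (j%:R + theta j.+1).
  by rewrite pE; [rewrite -natr1 addrK|lia].
have p0 : 0 < p j.+1 by rewrite pj divr_gt0// addr_gt0.
have up : - ln (p j.+1) <= theta j.+1 * j%:R^-1.
  have -> : - ln (p j.+1) = ln (1 + theta j.+1 * j%:R^-1).
    rewrite -lnV ?posrE// pj invf_div; congr ln.
    by rewrite mulrDl divff// gt_eqF.
  by rewrite le_ln1Dx// (lt_trans (ltrN10 _))// divr_gt0.
split=> //; apply/andP; split.
  apply: (@le_trans _ _ (1 - p j.+1)); last first.
    by have := ln_le_subr1 p0; lra.
  have -> : 1 - p j.+1 = theta j.+1 * p j.+1 * j%:R^-1.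
    by rewrite pj; field; rewrite !gt_eqF ?addr_gt0.
  by rewrite ler_wpM2l// mulr_ge0// ltW.
apply: (le_trans up); rewrite -mulrA ler_wpM2l ?(ltW t0)//.
apply: (@le_trans _ _ ((1 + j%:R^-1) * j.+1%:R^-1)).
  by rewrite le_eqVlt -natr1; apply/orP/or_introl/eqP; field; lra.
by rewrite ler_wpM2l// addr_ge0// invr_ge0 ltW.
Qed.

Let stay_cvg1 : p j.+1 @[j --> \oo] --> (1 : R).
Proof.
apply: (@squeeze_cvgr _ _ _ _ (fun j => 1 - theta j.+1 * j%:R^-1) (fun=> 1)).
- exists 2%N => //= j /= j2.
  have /andP[p0 p1] := @stay_prob_bounds j.+1 ltac:(lia).
  rewrite p1 andbT; have [_] := ln_stay_bounds j2.
  have := ln_le_subr1 p0; lra.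
- rewrite -[X in _ --> X]subr0; apply: cvgB; first exact: cvg_cst.
  rewrite -(mulr0 th); apply: cvgM inv_nat_cvg0.
  by apply/(cvg_succE theta).
- exact: cvg_cst.
Qed.

(* The main term telescopes: the sum of [logstep j] over m <= j < l is
   [ln (l / m)]. *)
Let ln_stay_near e : 0 < e -> \forall j \near \oo,
  `|- ln (p j.+1) - th * logstep j| <= e * logstep j /\ - ln (p j.+1) <= e.
Proof.
move=> e0.
have c0 : theta j.+1 @[j --> \oo] --> th by apply/(cvg_succE theta).
have c1 : theta j.+1 * p j.+1 @[j --> \oo] --> th.
  by rewrite -[X in _ --> X]mulr1; apply: cvgM.
have c3 : theta j.+1 * j%:R^-1 @[j --> \oo] --> 0.
  by rewrite -(mulr0 th); apply: cvgM.
have c2 : theta j.+1 * (1 + j%:R^-1) @[j --> \oo] --> th.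
  rewrite -[X in _ --> X]addr0; under eq_fun do rewrite mulrDr mulr1.
  exact: cvgD.
move/cvgrPdist_le : c1 => /(_ _ e0) c1.
move/cvgrPdist_le : c2 => /(_ _ e0) c2.
move/cvgrPdist_le : c3 => /(_ _ e0) c3.
near=> j.
have j2 : (2 <= j)%N by near: j; exact: nbhs_infty_ge.
have [/andP[b1 b2] b3] := ln_stay_bounds j2.
have /andP[+ _] := @logstep_bounds j ltac:(lia).
move=> /(lt_le_trans _)-/(_ 0); rewrite invr_gt0 ltr0n => /(_ isT) l0.
have : `|th - theta j.+1 * p j.+1| <= e by near: j.
have : `|th - theta j.+1 * (1 + j%:R^-1)| <= e by near: j.
have : `|0 - theta j.+1 * j%:R^-1| <= e by near: j.
rewrite !ler_norml => /andP[d1 d2] /andP[d3 d4] /andP[d5 d6].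
split; last by lra.
rewrite -mulNr; apply/andP; split.
  rewrite lerBrDr -mulrDl; apply: le_trans b1.
  by rewrite ler_wpM2r ?(ltW l0)//; lra.
rewrite lerBlDr -mulrDl; apply: (le_trans b2).
by rewrite ler_wpM2r ?(ltW l0)//; lra.
Unshelve. all: by end_near. Qed.

(** Sums [ln_stay_near] over the factors [p k], m < k <= j, which are those of [next_cdf p j.+2 m].
    The error stays relative to ln(j/m), hence uniform in [m >= N]. *)
Let ln_next_cdf_near e : 0 < e -> exists2 N : nat, (2 <= N)%N &
  (forall m, (N <= m)%N -> - ln (p m) <= e) /\
  forall m j, (N <= m <= j)%N ->
  `|ln (next_cdf p j.+2 m) + th * ln (j%:R / m%:R)| <= e * ln (j%:R / m%:R).
Proof.
move=> e0; have [N _ HN] := ln_stay_near e0.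
exists (N.+2); first by lia.
split=> [m Nm|m j /andP[Nm mj]].
  by have [_] := HN m.-1 ltac:(rewrite /=; lia); rewrite prednK//; lia.
have m0 : (0 < m)%N by lia.
rewrite -(subnK mj); elim: (j - m)%N => [|k IH].
  by rewrite next_cdf_tail// divff ?pnatr_eq0 -?lt0n// ln1 !mulr0 addr0 normr0.
rewrite addSn; set l := (k + m)%N in IH *.
have l0 : (0 < l)%N by lia.
have -> : next_cdf p l.+3 m = next_cdf p l.+2 m * p l.+1.
  by case: m m0 {IH Nm mj} @l l0 => // m _ l l0; rewrite /next_cdf big_nat_recr//=; lia.
have -> : (l.+1%:R / m%:R : R) = (l%:R / m%:R) * (l.+1%:R / l%:R).
  by field; rewrite !pnatr_eq0 -!lt0n l0.
have /andP[p0 _] := @stay_prob_bounds l.+1 ltac:(lia).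
have G0 := next_cdf_gt0 stay_prob_bounds l.+2 m0.
rewrite lnM ?posrE//.
have -> : ln ((l%:R / m%:R) * (l.+1%:R / l%:R)) = ln (l%:R / m%:R) + logstep l.
  by rewrite lnM ?posrE ?divr_gt0 ?ltr0n.
have [+ _] := HN l ltac:(rewrite /=; lia).
move: IH; rewrite !ler_norml; lra.
Qed.

(** The quantile m satisfies p_m G(m) = G(m-1) < v <= G(m) with G = [next_cdf p j.+2], so ln G(m) is
    ln v up to -ln p_m, while it is also close to -th ln(j/m). *)
Let next_one_log_near (v e : R) : 0 < v < 1 -> 0 < e ->
  \forall j \near \oo, `|th * ln (j%:R / (next_one p j.+2 v)%:R) + ln v| <= e.
Proof.
move=> /andP[v0 v1] e0; have v01 : 0 < v <= 1 by rewrite v0 ltW.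
pose c := - ln v; have c0 : 0 < c by rewrite oppr_gt0 ln_lt0// v0.
(* With y = ln(j/m) the final error is at most e'(y + 1): [e' <= th / 2] forces y <= 2c/th = K - 1,
   and [e' * K <= e] concludes. *)
pose K := 2 * c / th + 1.
have K0 : 0 < K by rewrite addr_gt0// divr_gt0// mulr_gt0.
pose e' := Num.min (th / 2) (e / K).
have e'0 : 0 < e' by rewrite lt_min !divr_gt0.
have e'th : e' <= th / 2 by rewrite ge_min lexx.
have e'e : e' * K <= e by rewrite -ler_pdivlMr// ge_min lexx orbT.
have [N N2 [HN1 HN2]] := ln_next_cdf_near e'0.
near=> j.
have jN : (N <= j)%N by near: j; exact: nbhs_infty_ge.
have N0 : (0 : R) < N%:R by rewrite ltr0n ltnW.
have j0 : (0 : R) < j%:R by rewrite ltr0n (leq_trans _ jN)// ltnW.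
have jbig : 2 * c / th < ln (j%:R / N%:R).
  rewrite -ltr_expR lnK ?posrE ?divr_gt0// ltr_pdivlMr//.
  by near: j; exact: nbhs_infty_gtr.
set m := next_one p j.+2 v.
(* The estimates hold only from [N] on; by [jbig], [next_cdf p j.+2 N] has already dropped below
   [v], so the quantile lies beyond [N]. *)
have Nm : (N < m)%N.
  rewrite ltnNge (next_one_le stay_prob_bounds)// -ltNge.
  have G0 : 0 < next_cdf p j.+2 N.
    by rewrite (next_cdf_gt0 stay_prob_bounds)// ltnW.
  rewrite -ltr_ln ?posrE//.
  have := HN2 N j ltac:(by rewrite leqnn); rewrite ler_norml => /andP[_].
  set y := ln (j%:R / N%:R) in jbig *.
  have y0 : 0 <= y.
    by rewrite (le_trans _ (ltW jbig))// ltW// divr_gt0// mulr_gt0.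
  have e'y : e' * y <= th / 2 * y by apply: ler_wpM2r.
  move: jbig; rewrite ltr_pdivrMr// => yth.
  rewrite /c in yth; lra.
have mj : (m <= j)%N.
  by rewrite (next_one_le stay_prob_bounds)// next_cdf_tail ?(ltW v1)// -(ltr0n R).
have m0 : (0 < m)%N := leq_ltn_trans (leq0n N) Nm.
have := next_one_eq stay_prob_bounds v01 (isT : (0 < j.+2)%N) m0.
rewrite eqxx => /esym/andP[].
rewrite next_cdf_pred ?(ltn_trans N2 Nm)//.
have /andP[p0 _] := @stay_prob_bounds m (ltnW (leq_ltn_trans N2 Nm)).
have G0 : 0 < next_cdf p j.+2 m by rewrite (next_cdf_gt0 stay_prob_bounds).
have G1 := next_cdf_le1 stay_prob_bounds j.+2 m.
rewrite -ltr_ln ?posrE ?mulr_gt0// -ler_ln ?posrE// lnM ?posrE// => g1 g2.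
have := HN1 m (ltnW Nm); have := HN2 m j ltac:(by rewrite (ltnW Nm)).
have y0 : 0 <= ln (j%:R / m%:R : R).
  by rewrite ln_ge0// ler_pdivlMr ?ltr0n// mul1r ler_nat.
set y := ln (j%:R / m%:R) in y0 *.
rewrite !ler_norml => /andP[h1 h2] h3.
have ey : e' * y <= th / 2 * y by apply: ler_wpM2r.
have yc : y <= 2 * c / th by rewrite ler_pdivlMr// /c; lra.
have : e' * y <= e' * (2 * c / th) by apply: ler_wpM2l => //; exact: ltW.
have : e' * (2 * c / th) + e' <= e by rewrite -[X in _ + X]mulr1 -mulrDr.
move=> h4 h5; apply/andP; split; lra.
Unshelve. all: by end_near. Qed.

Lemma next_one_cvg (v : R) : 0 < v < 1 ->
  (next_one p i v)%:R / i%:R @[i --> \oo] --> v `^ th^-1.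
Proof.
move=> v01; have /andP[v0 _] := v01.
pose y j : R := ln (j%:R / (next_one p j.+2 v)%:R).
have cy : expR (- y j) @[j --> \oo] --> v `^ th^-1.
  have -> : v `^ th^-1 = expR (- (- ln v / th)).
    by rewrite /powR gt_eqF// mulNr opprK mulrC.
  apply: continuous_cvg; first exact: continuous_expR.
  apply: cvgN; have -> : y = (fun j => (th * y j) / th).
    by apply/funext => j; rewrite mulrAC divff ?mul1r// gt_eqF.
  apply: cvgMl; apply/cvgrPdist_le => e e0.
  near=> j; rewrite distrC opprK; near: j.
  exact: next_one_log_near.
apply/(cvg_succE (fun i => (next_one p i v)%:R / i%:R : R)).
apply/(cvg_succE (fun i => (next_one p i.+1 v)%:R / i.+1%:R : R)) => /=.
(* The ratio in [cy] is over j instead of i = j + 2; the missing factor j/(j+2) = 1 - 2/(j+2) tends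
   to 1. *)
have ch : 1 - 2 * (j.+2%:R^-1 : R) @[j --> \oo] --> (1 : R).
  rewrite -[X in _ --> X]subr0; apply: cvgB; first exact: cvg_cst.
  rewrite -(mulr0 2); apply: cvgMr.
  apply/(cvg_succE (fun j => j.+1%:R^-1 : R)).
  exact: cvg_harmonic.
rewrite -[X in _ --> X]mulr1.
apply: cvg_trans (cvgM cy ch); apply: near_eq_cvg; near=> j.
have j0 : (0 : R) < j%:R by rewrite ltr0n; near: j; exact: nbhs_infty_gt.
rewrite /= /y expRN lnK ?posrE ?divr_gt0// invf_div.
have -> : 1 - 2 * (j.+2%:R^-1 : R) = j%:R / j.+2%:R.
  by rewrite -addn2 natrD; field; rewrite gt_eqF// addr_gt0.
by rewrite mulrA divfK// gt_eqF.
Unshelve. all: by end_near. Qed.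

End next_one_asymptotics.

(** * Laws on the space of sequences *)

Section product_measurability.
Context (R : realType).

(** The generators of [product_sigma_algebra], named so that the sigma-algebra can be carried by a
    measurable type. *)
Definition cylinders : set (set (nat -> R)) :=
  [set C | exists (i : nat) (B : set R),
     measurable B /\ C = [set x | B (x i)]].

Let seqR := g_sigma_algebraType cylinders.

Let measurable_coord j : measurable_fun [set: seqR] (fun x : seqR => x j).
Proof.
move=> _ B mB; rewrite setTI; apply: sub_sigma_algebra.
by exists j, B.
Qed.

Lemma measurable_fun_seq d (T : measurableType d) (A : nat -> T -> R) :
  (forall j, measurable_fun setT (A j)) ->
  measurable_fun setT (fun w => (fun j => A j w) : seqR).
Proof.
move=> mA; apply: (@measurability _ _ _ seqR setT _ cylinders) => // _ [_ [i [B [mB ->]]] <-].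
exact: mA.
Qed.

(** [round (code m x)] rounds the first [m] coordinates down to multiples of 1/(m+1) and sets the
    others to 0. There are only countably many codes. *)
Let round (m : nat) (c : {ffun 'I_m -> int}) : {ptws nat -> R} :=
  fun j => if insub j is Some i then (c i)%:~R / m.+1%:R else 0.

Let code (m : nat) (x : nat -> R) : {ffun 'I_m -> int} :=
  [ffun i => Num.floor (x (nat_of_ord i) * m.+1%:R)].

Let round_code_cvg (x : nat -> R) :
  round (code m x) @[m --> \oo] --> (x : {ptws nat -> R}).
Proof.
apply/pointwise_cvgP => j.
change ((fun m => round (code m x) j) @ \oo --> x j).
apply/cvgrPdist_le => e e0.
near=> m.
have jm : (j < m)%N by near: m; exact: nbhs_infty_gt.
rewrite /round insubT/= ffunE/=; set y := x j * _.
have m0 : (0 : R) < m.+1%:R by rewrite ltr0n.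
have -> : x j - (Num.floor y)%:~R / m.+1%:R = (y - (Num.floor y)%:~R) / m.+1%:R.
  by rewrite mulrBl mulfK// gt_eqF.
have /andP[] := floor_itv y; rewrite intrD => f1 f2.
rewrite ger0_norm; last by rewrite divr_ge0// ?subr_ge0// ltW.
apply: (@le_trans _ _ (1 / m.+1%:R)).
  by rewrite ler_pM2r ?invr_gt0//; lra.
rewrite ler_pdivrMr// mulrC -ler_pdivrMr// div1r.
have : e^-1 < m%:R by near: m; exact: nbhs_infty_gtr.
by move=> /ltW/le_trans; apply; rewrite ler_nat.
Unshelve. all: by end_near. Qed.

(** By continuity [f] is the pointwise limit of its values at the rounded sequences, and these
    depend on a countable code only. *)
Lemma continuous_measurable_seq (f : {ptws nat -> R} -> R) : continuous f ->
  measurable_fun setT (f : seqR -> R).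
Proof.
move=> cf.
apply: (@measurable_fun_cvg _ seqR R setT (fun m (x : seqR) => f (round (code m x))) f); last first.
  move=> x _; apply: continuous_cvg; first exact: cf.
  exact: round_code_cvg.
move=> m _ B mB; rewrite setTI.
have -> : (fun x : seqR => f (round (code m x))) @^-1` B =
  \bigcup_(c : {ffun 'I_m -> int})
    (if `[< B (f (round c)) >] then [set x : seqR | code m x = c] else set0).
  apply/seteqP; split => x /=.
    by move=> Bx; exists (code m x) => //; case: asboolP.
  by case=> c _; case: asboolP => //= Bc ->.
apply: countable_bigcupT_measurable => [|c]; first exact: countableP.
case: ifP => _ //.
(* A fibre of the code is a finite intersection of cylinders over half-open intervals. *)
have -> : [set x : seqR | code m x = c] =
  \bigcap_(i in [set: 'I_m]) [set x : seqR |
    `[(c i)%:~R / m.+1%:R, (c i + 1)%:~R / m.+1%:R[%classic (x (nat_of_ord i))].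
  have cE (x : nat -> R) i : (Num.floor (x (nat_of_ord i) * m.+1%:R) == c i) =
    (x (nat_of_ord i) \in `[(c i)%:~R / m.+1%:R, (c i + 1)%:~R / m.+1%:R[).
    by rewrite floor_eq in_itv/= ler_pdivrMr// ltr_pdivlMr.
  apply/seteqP; split => x /=.
    by move=> xc i _ /=; rewrite -cE -xc ffunE.
  move=> H; apply/ffunP => i; rewrite ffunE; apply/eqP.
  by rewrite cE; exact: H.
apply: fin_bigcap_measurable => // i _.
have := measurable_coord i measurableT
  (measurable_itv `[(c i)%:~R / m.+1%:R, (c i + 1)%:~R / m.+1%:R[).
by rewrite setTI.
Qed.

Lemma measurable_continuous_seq d (T : measurableType d) (A : nat -> T -> R)
    (f : {ptws nat -> R} -> R) :
  (forall j, measurable_fun setT (A j)) -> continuous f ->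
  measurable_fun setT (fun w => f (fun j => A j w)).
Proof.
move=> mA cf; exact: measurableT_comp (continuous_measurable_seq cf)
  (measurable_fun_seq mA).
Qed.

Lemma bounded_integrable d (T : measurableType d) (P : probability T R)
    (g : T -> R) M : measurable_fun setT g -> (forall w, `|g w| <= M) ->
  P.-integrable setT (EFin \o g).
Proof.
move=> mg gM; apply: (@le_integrable _ _ _ P _ measurableT (EFin \o g) (cst M%:E)).
- exact/measurable_EFinP.
- by move=> w _; rewrite /= lee_fin (le_trans (gM w))// ler_norm.
- exact: finite_measure_integrable_cst.
Qed.

(** Both expectations are integrals of [f] against the pushforward on the sequence space, and the
    two pushforwards agree. *)
Lemma expectation_eq_law d (T : measurableType d) (P : probability T R)
    d' (T' : measurableType d') (P' : probability T' R)
    (A : nat -> T -> R) (A' : nat -> T' -> R) (f : {ptws nat -> R} -> R) :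
  (forall j, measurable_fun setT (A j)) ->
  (forall j, measurable_fun setT (A' j)) ->
  (forall E, product_sigma_algebra E ->
    P [set w | E (fun j => A j w)] = P' [set w | E (fun j => A' j w)]) ->
  continuous f -> (exists M, forall x, `|f x| <= M) ->
  ('E_P[fun w => f (fun j => A j w)] = 'E_P'[fun w => f (fun j => A' j w)])%E.
Proof.
move=> mA mA' PP' cf [M fM]; rewrite unlock.
have mf := continuous_measurable_seq cf.
have push d0 (T0 : measurableType d0) (P0 : probability T0 R) A0 :
    (forall j, measurable_fun setT (A0 j)) ->
    (\int[P0]_w (f (fun j => A0 j w))%:E =
     \int[pushforward P0 (fun w => (fun j => A0 j w) : seqR)]_x (f x)%:E)%E.
  move=> mA0; rewrite (integral_pushforward (measurable_fun_seq mA0))//=.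
    exact/measurable_EFinP.
  apply: bounded_integrable => //.
  exact: measurable_continuous_seq.
rewrite (push _ _ P A)// (push _ _ P' A')//.
apply: eq_measure_integral; [exact: measurable_fun_seq..|].
by move=> mA1 mA2 E mE _; exact: PP'.
Qed.

End product_measurability.

(** * The beta distribution with first parameter 1 *)

Section beta_one.
Context d (T : measurableType d) (R : realType) (P : probability T R).
Context (th : R) (W : {RV P >-> R}).
Hypotheses (th0 : 0 < th) (hW : beta_distributed 1 th W).

(** The density is k th (1-x)^(th-1) on ]0, 1[; [k] stays unknown until the total mass is
    computed. *)
Let k : R := (real_beta_fun 1 th)^-1 / th.

Let measurable_pre (B : set R) : measurable B -> measurable (W @^-1` B).
Proof. by move=> mB; rewrite -[X in measurable X]setTI; exact: measurable_funPT. Qed.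

Let is_derive_powR_onem (x e : R) : x < 1 ->
  is_derive x 1 (fun y => (1 - y) `^ e) (- (e * (1 - x) `^ (e - 1))).
Proof.
move=> x1.
have d1 : is_derive x 1 (fun y : R => 1 - y) (-1 : R).
  have := is_deriveB (is_derive_cst (1 : R) x 1) (is_derive_id x 1).
  by rewrite sub0r.
have d2 : is_derive (1 - x) 1 (@powR R ^~ e) (e * (1 - x) `^ (e - 1)).
  by apply: is_derive1_powR; rewrite subr_gt0.
by have := @is_derive1_comp _ (@powR R ^~ e) (fun y => 1 - y) _ _ _ d2 d1;
  rewrite mulrN1.
Qed.

Let continuous_powR_onem (x e : R) : x < 1 ->
  {for x, continuous (fun y : R => (1 - y) `^ e)}.
Proof.
move=> x1; apply: differentiable_continuous; apply/derivable1_diffP.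
by have [] := is_derive_powR_onem e x1.
Qed.

(** Fundamental theorem of calculus with primitive -k(1-x)^th. The endpoint 1 is left out because
    the density blows up there when [th < 1]. *)
Let beta_one_cc (a b : R) : 0 < a -> a < b -> b < 1 ->
  P (W @^-1` `[a, b]) = (k * ((1 - a) `^ th - (1 - b) `^ th))%:E.
Proof.
move=> a0 ab b1.
pose f x : R := (1 - x) `^ (th - 1) / real_beta_fun 1 th.
pose F x : R := - k * (1 - x) `^ th.
have FE (x : R) : x < 1 -> is_derive x 1 F (f x).
  move=> x1.
  have := is_deriveZ (- k) (is_derive_powR_onem th x1).
  move/is_derive_eq; apply.
  rewrite /f /k /GRing.scale/=; move: (real_beta_fun 1 th)^-1 => b'.
  by field; rewrite gt_eqF.
have lt1 (x : R) : x \in `]a, b[ -> x < 1.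
  by rewrite in_itv/= => /andP[_ xb]; exact: lt_trans xb b1.
have contF (x : R) : x < 1 -> {for x, continuous (F : R -> R)}.
  move=> x1; apply: differentiable_continuous; apply/derivable1_diffP.
  by have [] := FE x x1.
transitivity (\int[lebesgue_measure]_(x in `[a, b]) (f x)%:E)%E.
  transitivity (distribution P W `[a, b]%classic) => //.
  rewrite hW//; apply: eq_integral => x.
  rewrite inE/= in_itv/= => /andP[ax xb].
  rewrite /real_beta_pdf (lt_le_trans a0 ax) (le_lt_trans xb b1)/=.
  by rewrite subrr powRr0 mul1r.
rewrite (@continuous_FTC2 _ _ F)//.
- by rewrite -EFinB /F; congr EFin; ring.
- apply: continuous_in_subspaceT => x; rewrite inE/= in_itv/= => /andP[_ xb].
  apply: cvgMl; apply: continuous_powR_onem; exact: le_lt_trans xb b1.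
- split.
  + by move=> x /lt1 x1; have [] := FE x x1.
  + by apply: cvg_at_right_filter; apply: contF; exact: lt_trans ab b1.
  + by apply: cvg_at_left_filter; exact: contF.
- by move=> x /lt1 x1; rewrite derive1E; have [] := FE x x1.
Qed.

Let beta_one_co (a : R) : 0 < a -> a < 1 ->
  P (W @^-1` `[a, 1[) = (k * (1 - a) `^ th)%:E.
Proof.
move=> a0 a1.
(* The shift to [n.+2] makes [1 - u n] lie strictly between [a] and 1; these endpoints exhaust [[a,
   1[]. *)
pose u n : R := (1 - a) * n.+2%:R^-1.
have a10 : 0 < 1 - a by rewrite subr_gt0.
have u0 n : 0 < u n by rewrite mulr_gt0.
have u_lt n : u n < 1 - a by rewrite gtr_pMr// invf_lt1// ltr1n.
have u_cvg : u n @[n --> \oo] --> 0.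
  rewrite -(mulr0 (1 - a)); apply: cvgMr.
  by apply/(cvg_succE (fun n => n.+1%:R^-1 : R)); exact: cvg_harmonic.
have bigcupE : \bigcup_n (W @^-1` `[a, 1 - u n]) = W @^-1` `[a, 1[.
  apply/seteqP; split => [w [n _]|w] /=; rewrite !in_itv/= => /andP[aw wb].
    by rewrite aw/= (le_lt_trans wb)// ltrBlDr ltrDl.
  move/cvgrPdist_lt : u_cvg => /(_ (1 - W w)).
  rewrite subr_gt0 => /(_ wb)[N _ /(_ N (leqnn N))].
  rewrite sub0r normrN gtr0_norm// => uw.
  by exists N => //=; rewrite in_itv/= aw/=; lra.
apply: (@cvg_unique _ _ (P (W @^-1` `[a, 1 - u n]) @[n --> \oo])) => //.
- rewrite -bigcupE.
  apply: nondecreasing_cvg_mu.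
  + by move=> n; exact: measurable_pre.
  + by apply: bigcupT_measurable => n; exact: measurable_pre.
  + move=> m n mn; apply/subsetPset => w /=; rewrite !in_itv/= => /andP[-> wb]/=.
    rewrite (le_trans wb)// lerB// ler_wpM2l ?(ltW a10)//.
    by rewrite ler_pV2 ?inE ?unitfE ?ltr0n ?pnatr_eq0//= ler_nat.
- rewrite (_ : (fun n => P _) = (fun n => (k * ((1 - a) `^ th - u n `^ th))%:E)).
    apply: cvg_EFin; first exact: nearW.
    rewrite -[X in _ --> X](_ : k * ((1 - a) `^ th - 0) = _); last by rewrite subr0.
    apply: cvgMr; apply: cvgB; first exact: cvg_cst.
    have /cvg_at_rightP := @powR_cvg0 R th th0.
    by apply; split.
  apply/funext => n; rewrite beta_one_cc//; first by rewrite subKr.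
    by rewrite ltrBrDr -ltrBrDl.
  by rewrite ltrBlDr ltrDl.
Qed.

Let oo_null : P (W @^-1` ~` [set x | 0 < x < 1]) = 0%E.
Proof.
transitivity (distribution P W (~` [set x | 0 < x < 1])) => //.
have -> : [set x : R | 0 < x < 1] = `]0, 1[%classic.
  by apply/seteqP; split => x /=; rewrite in_itv.
rewrite hW; last exact: measurableC.
rewrite -[RHS](integral0 lebesgue_measure (~` `]0, 1[%classic : set R)).
apply: eq_integral => x; rewrite inE/= in_itv/= => /negP/negbTE x01.
by rewrite /real_beta_pdf x01.
Qed.

Let measurable_oo : measurable (~` [set x : R | 0 < x < 1]).
Proof.
have -> : [set x : R | 0 < x < 1] = `]0, 1[%classic.
  by apply/seteqP; split => x /=; rewrite in_itv.
exact: measurableC.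
Qed.

Lemma ae_beta_one : {ae P, forall w, 0 < W w < 1}.
Proof.
exists (W @^-1` ~` [set x | 0 < x < 1]); split => //.
exact: measurable_pre.
Qed.

Let beta_one_oo : P (W @^-1` `]0, 1[) = 1%E.
Proof.
rewrite -(setCK (W @^-1` `]0, 1[)) probability_setC.
  rewrite [P _](_ : _ = 0%E) ?sube0// -[RHS]oo_null; congr (P _).
exact/measurableC/measurable_pre.
Qed.

(* The total mass is 1, which gives the normalising constant of the density. *)
Let k1 : k = 1.
Proof.
suff : k%:E = 1%E :> \bar R by case.
pose u n : R := n.+2%:R^-1.
have u0 n : 0 < u n by rewrite invr_gt0.
have u_lt n : u n < 1 by rewrite invf_lt1// ltr1n.
have u_cvg : u n @[n --> \oo] --> 0.
  by apply/(cvg_succE (fun n => n.+1%:R^-1 : R)); exact: cvg_harmonic.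
have bigcupE : \bigcup_n (W @^-1` `[u n, 1[) = W @^-1` `]0, 1[.
  apply/seteqP; split => [w [n _]|w] /=; rewrite !in_itv/= => /andP[aw wb].
    by rewrite wb andbT (lt_le_trans _ aw).
  move/cvgrPdist_lt : u_cvg => /(_ _ aw)[N _ /(_ N (leqnn N))].
  rewrite sub0r normrN gtr0_norm// => uw.
  by exists N => //=; rewrite in_itv/= wb ltW.
apply: (@cvg_unique _ _ (P (W @^-1` `[u n, 1[) @[n --> \oo])) => //.
- rewrite (_ : (fun n => P _) = (fun n => (k * (1 - u n) `^ th)%:E)); last first.
    by apply/funext => n; rewrite beta_one_co.
  apply: cvg_EFin; first exact: nearW.
  rewrite -[X in _ --> X](_ : k * (1 - 0) `^ th = _); last first.
    by rewrite subr0 powR1 mulr1.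
  apply: cvgMr.
  apply: (@cvg_comp _ _ _ u (fun x : R => (1 - x) `^ th) _ (nbhs 0)) => //.
  exact: continuous_powR_onem.
- rewrite -beta_one_oo -bigcupE; apply: nondecreasing_cvg_mu.
  + by move=> n; exact: measurable_pre.
  + by apply: bigcupT_measurable => n; exact: measurable_pre.
  + move=> m n mn; apply/subsetPset => w /=; rewrite !in_itv/= => /andP[aw ->].
    rewrite andbT; apply: le_trans aw.
    by rewrite ler_pV2 ?inE ?unitfE ?ltr0n ?pnatr_eq0//= ler_nat.
Qed.

(** For 0 < c < 1 the event is that W lies in [1 - c^(1/th), 1[, of mass c by [beta_one_co]; c = 0
    and c = 1 fall outside the range of that lemma. *)
Lemma beta_one_uniform (c : R) : 0 <= c <= 1 ->
  P [set w | 0 < W w < 1 /\ (1 - W w) `^ th <= c] = c%:E.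
Proof.
have one_th : 1 `^ th = 1 :> R by rewrite powR1.
move=> /andP[c0 c1].
have [->|c_neq0] := eqVneq c 0.
  rewrite (_ : [set w | _ ] = set0) ?measure0//.
  apply/seteqP; split => // w [/andP[w0 w1]] /=; apply/negP.
  by rewrite -ltNge powR_gt0// subr_gt0.
have {c_neq0}c0 : 0 < c by rewrite lt_neqAle eq_sym c_neq0.
have [->|c_neq1] := eqVneq c 1.
  rewrite -beta_one_oo; congr (P _); apply/seteqP; split=> w /=.
    by case=> w01 _; rewrite in_itv.
  rewrite in_itv/= => /andP[w0 w1]; rewrite w0 w1; split=> //.
  rewrite -[leRHS]one_th; apply: ge0_ler_powR; rewrite ?nnegrE ?ltW//; lra.
have {c_neq1}c1 : c < 1 by rewrite lt_neqAle c_neq1.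
pose b := c `^ th^-1.
have bE : b `^ th = c by rewrite /b -powRrM mulVf ?powRr1 ?ltW// gt_eqF.
have b0 : 0 < b by rewrite powR_gt0.
have b1 : b < 1.
  rewrite ltNge; apply/negP => b1; have := c1; rewrite -bE ltNge => /negP; apply.
  by rewrite -[leLHS]one_th; apply: ge0_ler_powR; rewrite ?nnegrE// ltW.
have := beta_one_co (a := 1 - b); rewrite subr_gt0 k1 mul1r subKr bE => <-//.
  congr (P _); apply/seteqP; split=> w /=; rewrite in_itv/=.
    move=> [/andP[w0 w1]]; rewrite w1 andbT -bE => wb.
    rewrite lerBlDr -lerBlDl leNgt; apply/negP => bw.
    have := gt0_ltr_powR th0 (ltW b0 : b \in Num.nneg) (_ : 1 - W w \in Num.nneg) bw.
    rewrite nnegrE subr_ge0 ltW// => /(_ isT); by rewrite ltNge wb.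
  move=> /andP[bw w1]; rewrite w1 andbT; split; first by lra.
  rewrite -bE; apply: ge0_ler_powR; rewrite ?nnegrE ?(ltW th0) ?(ltW b0)//; lra.
by rewrite ltrBlDr ltrDl.
Qed.

End beta_one.

(** * The law of the derangement process *)

Lemma le_measure_ae d (T : measurableType d) (R : realType)
    (mu : {measure set T -> \bar R}) (A B : set T) :
  measurable A -> measurable B -> {ae mu, forall w, A w -> B w} ->
  (mu A <= mu B)%E.
Proof.
move=> mA mB [N [mN N0 AB]]; rewrite -[leRHS]adde0 -N0.
apply: le_trans (measureU2 mu mB mN).
apply: le_measure; rewrite ?inE//; first exact: measurableU.
move=> w Aw; have [?|nB] := pselect (B w); [by left|right].
by apply: AB => /(_ Aw).
Qed.

(** Compares events atom by atom. The [e'] are not assumed to cover the second space: equality of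
    masses forces it up to a null set. *)
Lemma eq_prob_finite_partition (R : realType) d (T : measurableType d)
    (P : probability T R) d' (T' : measurableType d') (P' : probability T' R)
    (I : finType) (e : I -> set T) (e' : I -> set T') (Q : set I) A A' :
  (forall i, measurable (e i)) -> (forall i, measurable (e' i)) ->
  trivIset setT e -> trivIset setT e' ->
  \bigcup_i e i = setT -> (forall i, P (e i) = P' (e' i)) ->
  (forall i w, e i w -> (A w <-> Q i)) ->
  (forall i w, e' i w -> (A' w <-> Q i)) -> measurable A' ->
  P A = P' A'.
Proof.
move=> me me' te te' eT Pe eA eA' mA'.
have fI (D : set I) : finite_set D by exact: finite_finset.
have sumE (D : set I) : P (\bigcup_(i in D) e i) = P' (\bigcup_(i in D) e' i).
  rewrite (measure_fin_bigcup P)//; last exact: sub_trivIset te.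
  rewrite (measure_fin_bigcup P')//; last exact: sub_trivIset te'.
  by apply: eq_fsbigr => i _; exact: Pe.
have mD (D : set I) : measurable (\bigcup_(i in D) e' i).
  by apply: fin_bigcup_measurable.
have -> : A = \bigcup_(i in Q) e i.
  apply/seteqP; split => [w Aw|w [i Qi ei]]; last by apply/eA; first exact: ei.
  have [i _ ei] : (\bigcup_i e i) w by rewrite eT.
  by exists i => //; apply/(eA i w).
rewrite sumE; apply/eqP; rewrite eq_le; apply/andP; split.
  apply: le_measure; rewrite ?inE//.
  by move=> w [i Qi ei]; apply/(eA' i w).
have n0 : P' (~` \bigcup_i e' i) = 0%E.
  by rewrite probability_setC// -sumE eT probability_setT subee.
apply: le_measure_ae => //; exists (~` \bigcup_i e' i); split.
- exact: measurableC.
- exact: n0.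
- move=> w /= H [i _ ei]; apply: H => A'w.
  by exists i => //; apply/(eA' i w).
Qed.

Section derangement_law.
Context d (T : measurableType d) (R : realType) (P : probability T R).
Context (p : nat -> R) (n : nat) (X : nat -> {RV P >-> bool}).
Hypotheses (hn : (2 <= n)%N) (hX : derangement_process p n X).

Let measurable_state r b : measurable (state_event X r b).
Proof.
have -> : state_event X r b = X r @^-1` [set b] by [].
by rewrite -[X in measurable X]setTI; exact: measurable_funPT.
Qed.

Let past_pred r (x : nat -> bool) : (0 < r <= n.+1)%N ->
  past_event X n r.-1 x = past_event X n r x `&` state_event X r (x r).
Proof.
move=> /andP[r0 rn]; apply/seteqP; split => w /=.
  move=> H; split; last by apply: H; lia.
  by move=> k kr; apply: H; lia.
move=> [H1 H2] k kr; have [->|kr'] := eqVneq k r; first exact: H2.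
by apply: H1; lia.
Qed.

Lemma measurable_past_event r (x : nat -> bool) : measurable (past_event X n r x).
Proof.
have -> : past_event X n r x =
    \bigcap_(k in [set k | (r < k <= n.+1)%N]) state_event X k (x k).
  by [].
by apply: bigcap_measurableType => k _; exact: measurable_state.
Qed.
Let mpast := measurable_past_event.

Let ae_state r b A c : {ae P, forall w, X r w = b} -> measurable A ->
  P (A `&` state_event X r c) = if b == c then P A else 0%E.
Proof.
move=> Xb mA; have mAs c' : measurable (A `&` state_event X r c').
  exact: measurableI.
apply/eqP; rewrite eq_le; have [<-|bc] := eqVneq b c.
  rewrite le_measure ?inE//=; apply: le_measure_ae => //.
  by apply: filterS Xb => w wb Aw.
rewrite measure_ge0 andbT -(measure0 P); apply: le_measure_ae => //.
apply: filterS Xb => w wb [_ wc]; move: bc.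
by rewrite -wb -(wc : X r w = c) eqxx.
Qed.

(** The steps to X_1 and X_n come from the almost sure values; the others combine the Markov
    property with the one-step conditional probabilities. *)
Let past_step r (x : nat -> bool) : x n.+1 -> (0 < r <= n)%N ->
  P (past_event X n r.-1 x) =
  (P (past_event X n r x) * (transition p r (x r.+1) (x r))%:E)%E.
Proof.
move=> xn /andP[r0 rn]; rewrite past_pred ?r0 ?leqW//.
(* A null past gives no conditional information, but then both sides vanish. *)
have [Pr0|Pr0] := eqVneq (P (past_event X n r x)) 0%E.
  rewrite Pr0 mul0e; apply/eqP; rewrite eq_le measure_ge0 andbT -Pr0.
  by apply: le_measure; rewrite ?inE//; exact: measurableI.
rewrite /transition; case: eqVneq => [r1|r1].
  rewrite r1 (ae_state _ (derangement_last hX))//.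
  by case: (x 1%N); rewrite ?mule1 ?mule0.
have [rnE|rnE] := eqVneq r n.
  rewrite rnE xn (ae_state _ (derangement_first hX))//.
  by case: (x n); rewrite ?mule1 ?mule0.
have rn1 : (2 <= r <= n.-1)%N by lia.
have fin A : measurable A -> P A \is a fin_num by move=> mA; exact: fin_num_measure.
have sub : past_event X n r x `<=` state_event X r.+1 (x r.+1).
  by move=> w; apply; lia.
have Ps0 : P (state_event X r.+1 (x r.+1)) != 0%E.
  apply: contra Pr0 => /eqP s0; rewrite eq_le measure_ge0 andbT -s0.
  by apply: le_measure; rewrite ?inE.
have fine0 A : measurable A -> P A != 0%E -> fine (P A) != 0.
  by move=> mA; apply: contra => /eqP PA; rewrite -(fineK (fin _ mA)) PA.
have := derangement_markov hX (r := r) (x := x).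
rewrite r0 rn => /(_ isT Pr0).
rewrite {1}/cond_prob => /(congr1 ( *%R^~ (fine (P (past_event X n r x))))).
rewrite divfK; last exact: fine0.
rewrite setIC => Hm.
rewrite -[LHS]fineK; last exact/fin/measurableI.
rewrite Hm EFinM fineK; last exact: fin.
rewrite muleC; congr (_ * _%:E)%E.
case xr1 : (x r.+1) Ps0 => Ps0; last first.
  have [H0 H1] := derangement_after0 hX rn1 Ps0.
  by case: (x r).
have H0 := derangement_after1 hX rn1 Ps0.
(* Only the probability of a zero after a one is given; splitting the conditioning event shows that
   a second one has probability 0. *)
case: (x r) => //=.
move: H0; rewrite /cond_prob.
set S := state_event X r.+1 true.
have mS : measurable S by exact: measurable_state.
move/(congr1 ( *%R^~ (fine (P S)))); rewrite divfK ?mul1r; last exact: fine0.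
have SE : S = (state_event X r false `&` S) `|` (state_event X r true `&` S).
  rewrite -setIUl (_ : _ `|` _ = setT) ?setTI//.
  apply/seteqP; split => // w _ /=; rewrite /state_event /=.
  by case: (X r w); [right|left].
rewrite {2}SE measureU; [|exact: measurableI..|]; last first.
  apply/seteqP; split => // w [[w1 _] [w2 _]].
  by have : X r w = true by []; rewrite (w1 : X r w = false).
rewrite fineD; [|exact/fin/measurableI..].
by move=> /esym/eqP; rewrite -subr_eq0 addrAC subrr add0r => /eqP ->; rewrite mul0r.
Qed.

Lemma past_event_prod r (x : nat -> bool) : (r <= n)%N -> x n.+1 ->
  P (past_event X n r x) =
  (\prod_(r.+1 <= k < n.+1) transition p k (x k.+1) (x k))%:E.
Proof.
move=> rn xn.
elim: {r}(n - r)%N {-2}r (erefl (n - r)%N) rn => [|m IH] r mr rn.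
  have -> : r = n by lia.
  rewrite big_geq// -[n in past_event _ _ n]/(n.+1.-1) past_pred ?leqnn//.
  rewrite (ae_state _ (derangement_start hX))// xn eqxx.
  rewrite (_ : past_event _ _ _ _ = setT) ?probability_setT//.
  by apply/seteqP; split => // w _ k; lia.
have rn1 : (r < n)%N by lia.
rewrite -[r in past_event _ _ r]/(r.+1.-1) past_step// IH//; last by lia.
by rewrite [in RHS]big_ltn// -EFinM mulrC.
Qed.

Lemma derangement_law (x : nat -> bool) : P (past_event X n 0 x) =
  (if x n.+1 && x 1%N then path_weight p (ones_from n 0 x) else 0)%:E.
Proof.
case xn : (x n.+1) => /=.
  case x1 : (x 1%N) => /=.
    by rewrite past_event_prod// prod_transition//; lia.
  rewrite (past_pred x (isT : (0 < 1 <= n.+1)%N)).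
  by rewrite (ae_state _ (derangement_last hX))// x1.
apply/eqP; rewrite eq_le measure_ge0 andbT.
apply: (@le_trans _ _ (P (setT `&` state_event X n.+1 false))); last first.
  by rewrite (ae_state _ (derangement_start hX)).
rewrite setTI; apply: le_measure; rewrite ?inE//.
by move=> w H; rewrite /state_event/= -xn; apply: H; lia.
Qed.

End derangement_law.

(** * The coupling *)

Lemma measurable_countable_fibers d (T : measurableType d) (I : countType)
    (Z : T -> I) (Q : set I) :
  (forall i, measurable (Z @^-1` [set i])) -> measurable (Z @^-1` Q).
Proof.
move=> mZ; rewrite (_ : Z @^-1` Q = \bigcup_(i : I)
    (if `[< Q i >] then Z @^-1` [set i] else set0)).
  apply: countable_bigcupT_measurable => [|i]; first exact: countableP.
  by case: ifP.
apply/seteqP; split => w /=.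
  by move=> Qw; exists (Z w) => //; case: asboolP.
by case=> i _; case: asboolP => //= Qi ->.
Qed.

(* The coupling: the chain of positions driven by [(1 - u j) `^ th]. *)
Definition position (R : realType) (p : nat -> R) (th : R) (n : nat) (u : nat -> R) :
    nat -> nat :=
  fix M j := if j is j'.+1 then next_one p (M j') ((1 - u j') `^ th) else n.+1.

Definition position_gaps (R : realType) (n : nat) (M : nat -> nat) :
    {ptws nat -> R} :=
  fun j => n%:R^-1 * (M j - M j.+1)%:R.

Section positions.
Context (R : realType) (p : nat -> R) (th : R).

Let next_one_leq i v : (0 < i)%N -> (next_one p i v <= i)%N.
Proof.
by move=> i0; rewrite -(prednK i0) ltnS; apply: sum_bool_le; rewrite subn1.
Qed.

Lemma position_gt0 n u j : (0 < position p th n u j)%N.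
Proof. by case: j. Qed.

Lemma position_leq n u j : (position p th n u j.+1 <= position p th n u j)%N.
Proof. exact/next_one_leq/position_gt0. Qed.

(** [next_one] depends on the level only through finitely many comparisons. *)
Lemma measurable_next_one i m :
  measurable [set x : R | next_one p i ((1 - x) `^ th) = m].
Proof.
pose Z (x : R) : {ffun 'I_i -> bool} := [ffun k : 'I_i => next_cdf p i k < (1 - x) `^ th].
have E (x : R) : next_one p i ((1 - x) `^ th) = (\sum_(k < i | (0 < k)%N) Z x k)%N.+1.
  rewrite /next_one; congr S; rewrite big_geq_mkord.
  by apply: eq_bigr => k _; rewrite ffunE.
rewrite (_ : [set x | _] =
    Z @^-1` [set c : {ffun 'I_i -> bool} | (\sum_(k < i | (0 < k)%N) c k)%N.+1 = m]);
  last by apply/seteqP; split => x /=; rewrite E.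
apply: measurable_countable_fibers => c.
have -> : Z @^-1` [set c] =
    \bigcap_(k in [set: 'I_i]) [set x | (next_cdf p i k < (1 - x) `^ th) = c k].
  apply/seteqP; split => x /=.
    by move=> <- k _ /=; rewrite ffunE.
  by move=> H; apply/ffunP => k; rewrite ffunE; exact: H.
apply: fin_bigcap_measurable => // k _.
have mf : measurable_fun setT (fun x : R => next_cdf p i k < (1 - x) `^ th).
  apply: measurable_fun_ltr; first exact: measurable_cst.
  apply: (measurableT_comp (measurable_powR th)).
  exact: measurable_funB.
by rewrite -[X in measurable X]setTI; exact: (mf measurableT [set c k]).
Qed.

Section measurability.
Context d (T : measurableType d) (W : nat -> T -> R) (n : nat).
Hypothesis mW : forall j, measurable_fun setT (W j).

Lemma measurable_next_one_pre j i m :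
  measurable [set w | next_one p i ((1 - W j w) `^ th) = m].
Proof. by rewrite -[X in measurable X]setTI; exact: (mW j measurableT (measurable_next_one i m)). Qed.

Let measurable_position j m :
  measurable [set w | position p th n (W ^~ w) j = m].
Proof.
elim: j m => [|j IH] m.
  rewrite /=; have [->|ne] := eqVneq m n.+1.
    by rewrite (_ : [set _ | _] = setT)//; apply/seteqP.
  rewrite (_ : [set _ | _] = set0)//; apply/seteqP; split => // w /= /esym/eqP.
  by apply/negP.
rewrite (_ : [set w | _] = \bigcup_i ([set w | position p th n (W ^~ w) j = i] `&`
    [set w | next_one p i ((1 - W j w) `^ th) = m])).
  apply: bigcupT_measurable => i; apply: measurableI; first exact: IH.
  exact: measurable_next_one_pre.
apply/seteqP; split => w /=; first by move=> H; exists (position p th n (W ^~ w) j).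
by case=> i _ [/= <-].
Qed.

Lemma measurable_position_gaps j :
  measurable_fun setT (fun w => position_gaps R n (position p th n (W ^~ w)) j).
Proof.
move=> _ B mB; rewrite setTI.
pose Z w := (position p th n (W ^~ w) j, position p th n (W ^~ w) j.+1).
apply: (@measurable_countable_fibers _ _ _ Z
  [set ab | B (n%:R^-1 * (ab.1 - ab.2)%:R)]) => -[a b].
rewrite (_ : Z @^-1` _ = [set w | position p th n (W ^~ w) j = a] `&`
    [set w | position p th n (W ^~ w) j.+1 = b]).
  by apply: measurableI; exact: measurable_position.
apply/seteqP; split => w; last by case=> h1 h2; exact: (congr2 pair h1 h2).
by move=> Zw; split; [exact: (congr1 fst Zw)|exact: (congr1 snd Zw)].
Qed.

End measurability.

Section limit.
Hypothesis next_one_lim : forall v, 0 < v < 1 ->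
  (next_one p i v)%:R / i%:R @[i --> \oo] --> v `^ th^-1.
Hypothesis th0 : 0 < th.

(** By induction on [j], the position over n tends to the product of the first [j] factors 1 - u_i:
    the ratio of successive positions is given by the quantile limit. Differences of these products
    are the stick-breaking pieces. *)
Lemma position_gaps_cvg (u : nat -> R) : (forall i, 0 < u i < 1) ->
  position_gaps R n (position p th n u) @[n --> \oo] --> stick_breaking u.
Proof.
move=> u01.
pose M n := position p th n u.
have cM j : (M n j)%:R / n%:R @[n --> \oo] --> \prod_(i < j) (1 - u i).
  elim: j => [|j IH].
    rewrite big_ord0 /=.
    have c : (1 + n%:R^-1 : R) @[n --> \oo] --> (1 : R).
      rewrite -[X in _ --> X]addr0; apply: cvgD; first exact: cvg_cst.
      by apply/cvg_succE; exact: cvg_harmonic.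
    apply: cvg_trans c; apply: near_eq_cvg; near=> n.
    have n0 : (0 : R) < n%:R by rewrite ltr0n; near: n; exact: nbhs_infty_gt.
    by rewrite /M/= -natr1 mulrDl divff ?gt_eqF// mul1r.
  have P0 : 0 < \prod_(i < j) (1 - u i).
    by apply: prodr_gt0 => i _; have /andP[_] := u01 i; rewrite subr_gt0.
  (* The quantile limit is taken as the current position grows; it does, being eventually above n
     times half of the positive limit. *)
  have Moo : M n j @[n --> \oo] --> \oo.
    apply/cvgnyPge => A.
    move/cvgrPdist_lt : (IH) => /(_ _ (divr_gt0 P0 (ltr0Sn R 1))) H.
    near=> n.
    have n0 : (0 : R) < n%:R by rewrite ltr0n; near: n; exact: nbhs_infty_gt.
    have : `|\prod_(i < j) (1 - u i) - (M n j)%:R / n%:R| <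
      \prod_(i < j) (1 - u i) / 2 by near: n.
    rewrite ltr_norml => /andP[_ h].
    have : A%:R * (\prod_(i < j) (1 - u i) / 2)^-1 < n%:R.
      by near: n; exact: nbhs_infty_gtr.
    rewrite ltr_pdivrMr ?divr_gt0// => h'.
    have h2 : \prod_(i < j) (1 - u i) / 2 < (M n j)%:R / n%:R by lra.
    move: h2; rewrite ltr_pdivlMr// mulrC => h2.
    by rewrite -(ler_nat R) ltW// (lt_trans h').
  have /andP[uj0 uj1] := u01 j.
  have v01 : 0 < (1 - u j) `^ th < 1.
    have uj : 0 < 1 - u j by rewrite subr_gt0.
    rewrite powR_gt0//=.
    have := gt0_ltr_powR th0 (_ : 1 - u j \in Num.nneg) (_ : 1 \in Num.nneg) (_ : 1 - u j < 1).
    by rewrite powR1; apply; rewrite ?nnegrE ?ltW//; lra.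
  have c : (next_one p (M n j) ((1 - u j) `^ th))%:R / (M n j)%:R
      @[n --> \oo] --> 1 - u j.
    rewrite -[X in _ --> X](_ : ((1 - u j) `^ th) `^ th^-1 = _).
      exact: (@cvg_comp _ _ _ (M ^~ j) (fun i => (next_one p i _)%:R / i%:R)
        _ _ _ Moo (next_one_lim v01)).
    by rewrite -powRrM divff ?gt_eqF// powRr1 ?subr_ge0 ?ltW.
  rewrite big_ord_recr/= mulrC.
  apply: cvg_trans (cvgM c IH); apply: near_eq_cvg; near=> n.
  rewrite /M/= -/(M n j) mulrA divfK//.
  by rewrite pnatr_eq0 -lt0n position_gt0.
apply/pointwise_cvgP => j.
change ((fun n => position_gaps R n (position p th n u) j) @ \oo -->
  stick_breaking u j).
rewrite (_ : stick_breaking u j =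
    \prod_(i < j) (1 - u i) - \prod_(i < j.+1) (1 - u i)); last first.
  by rewrite big_ord_recr/= -[X in X - _]mulr1 -mulrBr subKr.
rewrite (_ : (fun n => _) = (fun n => (M n j)%:R / n%:R - (M n j.+1)%:R / n%:R)).
  by apply: cvgB.
by apply/funext => n; rewrite /position_gaps natrB ?position_leq// mulrBr !(mulrC n%:R^-1).
Unshelve. all: by end_near. Qed.

End limit.

End positions.

(** * Lists of ones and cycle lengths *)

Section ones.
Context (n : nat).
Implicit Types x y : nat -> bool.

Lemma mem_ones_from x r : (r \in ones_from n 0 x) = (0 < r <= n.+1)%N && x r.
Proof. by rewrite /ones_from mem_filter mem_rev mem_iota subn0 add1n andbC ltnS. Qed.

Lemma size_ones_from x : x n.+1 -> size (ones_from n 0 x) = (cycle_count n x).+1.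
Proof.
move=> xn; rewrite /ones_from subn0 size_filter count_rev -sum1_count big_mkcond.
have -> : iota 1 n.+1 = index_iota 1 n.+2 by rewrite /index_iota subn1.
by rewrite big_nat_recr//= xn addn1.
Qed.

Lemma ones_from_head x : x n.+1 -> nth 1%N (ones_from n 0 x) 0 = n.+1.
Proof.
by move=> xn; rewrite /ones_from subn0 -(addn1 n) iotaD rev_cat/= add1n xn/= addn1.
Qed.

(** The default of [nth] is chosen equal to the final entry 1, so the list continues constantly,
    like [position], for which 1 is a fixed point. *)
Lemma ones_from_last x j : (0 < n)%N -> x 1%N ->
  ((size (ones_from n 0 x)).-1 <= j)%N -> nth 1%N (ones_from n 0 x) j = 1%N.
Proof.
move=> n0 x1; have := @ones_from_pred n 1 x n0; rewrite /= x1 => ->.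
rewrite size_rcons/= leq_eqVlt nth_rcons => /orP[/eqP <-|sj].
  by rewrite ltnn eqxx.
by rewrite ltnNge (ltnW sj)/= gtn_eqF.
Qed.

Lemma mem_nth_ones_from x j : (0 < n)%N -> x 1%N ->
  nth 1%N (ones_from n 0 x) j \in ones_from n 0 x.
Proof.
move=> n0 x1; have [js|sj] := ltnP j (size (ones_from n 0 x)).
  exact: mem_nth.
by rewrite nth_default// mem_ones_from x1.
Qed.

(** The bit at [r] is membership of [r] in the list. *)
Lemma eq_ones_from x y : (0 < n)%N -> x 1%N -> y 1%N ->
  nth 1%N (ones_from n 0 x) =1 nth 1%N (ones_from n 0 y) ->
  forall r, (0 < r <= n.+1)%N -> x r = y r.
Proof.
have sub (x' y' : nat -> bool) : (0 < n)%N -> y' 1%N ->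
    nth 1%N (ones_from n 0 x') =1 nth 1%N (ones_from n 0 y') ->
    forall r, (0 < r <= n.+1)%N -> x' r -> y' r.
  move=> n0 y1 E r rn xr.
  have : r \in ones_from n 0 x' by rewrite mem_ones_from rn.
  move=> /(nthP 1%N)[j _]; rewrite E => jr.
  have := mem_nth_ones_from j n0 y1.
  by rewrite jr mem_ones_from => /andP[].
move=> n0 x1 y1 E r rn; by apply/idP/idP; apply: sub.
Qed.

(** For missing cycles both positions are 1, so the gap is 0, in agreement with the convention of
    [cycle_length]. *)
Lemma scaled_cycle_lengthsE (R : realType) x : (0 < n)%N -> x n.+1 -> x 1%N ->
  scaled_cycle_lengths R n x = position_gaps R n (nth 1%N (ones_from n 0 x)).
Proof.
move=> n0 xn x1; apply/funext => j.
rewrite /scaled_cycle_lengths /position_gaps /cycle_length; congr (_ * _%:R).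
have -> : one_positions n x = ones_from n 0 x by rewrite /ones_from subn0.
have sE := size_ones_from xn.
case: ifP => /= jc.
  by rewrite !(@set_nth_default _ _ 1%N 0%N)// sE ltnS// ltnW.
by rewrite !ones_from_last// sE /=; lia.
Qed.

Lemma eq_scaled_cycle_lengths (R : realType) x y :
  (forall r, (0 < r <= n.+1)%N -> x r = y r) ->
  scaled_cycle_lengths R n x = scaled_cycle_lengths R n y.
Proof.
move=> xy; apply/funext => j; rewrite /scaled_cycle_lengths /cycle_length.
have -> : one_positions n x = one_positions n y.
  apply: eq_in_filter => r; rewrite mem_rev mem_iota add1n ltnS => rn.
  exact: xy.
have -> // : cycle_count n x = cycle_count n y.
by apply: eq_big_nat => i i1; rewrite xy//; lia.
Qed.

End ones.

(** * Equality of the laws under the coupling *)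

Section coupling.
Context (R : realType) (p : nat -> R) (th : R).
Hypotheses (th0 : 0 < th) (p01 : forall k, (2 <= k)%N -> 0 < p k <= 1).
Context d' (T' : measurableType d') (P' : probability T' R).
Context (W : nat -> {RV P' >-> R}).
Hypotheses (iW : mutually_independent W)
           (bW : forall i, beta_distributed 1 th (W i)).

Let mW j : measurable_fun setT (W j) := measurable_funPT (W j).

(** With the positions fixed by [s], the [j]-th condition involves [W j] alone, so independence
    factors the intersection. *)
Definition path_event (s : seq nat) : set T' :=
  \bigcap_(j in [set` iota 0 (size s).-1])
    W j @^-1` [set x | next_one p (nth 1%N s j) ((1 - x) `^ th) = nth 1%N s j.+1].

(** The level is uniform, so a value of the quantile function has the mass of the corresponding
    increment of [next_cdf]. *)
Let next_one_prob j i m : (0 < i)%N -> (0 < m)%N ->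
  P' (W j @^-1` [set x | next_one p i ((1 - x) `^ th) = m]) =
  (next_cdf p i m - next_cdf p i m.-1)%:E.
Proof.
move=> i0 m0.
(* Restricting to 0 < W < 1, an almost sure event, puts the level in ]0, 1], as [next_one_eq]
   requires. *)
pose S c := [set w | 0 < W j w < 1 /\ (1 - W j w) `^ th <= c].
have mS c : measurable (S c).
  have -> : S c = W j @^-1` (`]0, 1[ `&` [set x | (1 - x) `^ th <= c]).
    by apply/seteqP; split => w /=; rewrite in_itv.
  rewrite -[X in measurable X]setTI; apply: (mW j measurableT).
  apply: measurableI => //.
  have mf : measurable_fun setT (fun x : R => (1 - x) `^ th).
    apply: (measurableT_comp (measurable_powR th)).
    exact: measurable_funB.
  have -> : [set x : R | (1 - x) `^ th <= c] =
      (fun x => (1 - x) `^ th) @^-1` `]-oo, c].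
    by apply/seteqP; split => x /=; rewrite in_itv.
  by rewrite -[X in measurable X]setTI; exact: mf.
have GS l : P' (S (next_cdf p i l)) = (next_cdf p i l)%:E.
  apply: (beta_one_uniform th0 (bW j)).
  by rewrite next_cdf_ge0//= next_cdf_le1.
transitivity (P' (S (next_cdf p i m) `\` S (next_cdf p i m.-1))).
  have H w : 0 < W j w < 1 ->
      next_one p i ((1 - W j w) `^ th) = m <->
      (S (next_cdf p i m) `\` S (next_cdf p i m.-1)) w.
    move=> w01; have v01 : 0 < (1 - W j w) `^ th <= 1.
      have /andP[w0 w1] := w01.
      rewrite powR_gt0 ?subr_gt0//=.
      have o : 1 `^ th = 1 :> R by rewrite powR1.
      rewrite -[leRHS]o; apply: ge0_ler_powR; rewrite ?nnegrE ?(ltW th0)//; lra.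
    rewrite /S/=; split.
      move/eqP; rewrite next_one_eq// => /andP[h1 h2]; split=> // -[_].
      by rewrite leNgt h1.
    move=> [[_ h2] h1]; apply/eqP; rewrite next_one_eq// h2 andbT ltNge.
    by apply/negP => h; apply: h1.
  have mL : measurable (W j @^-1` [set x | next_one p i ((1 - x) `^ th) = m]).
    exact: (measurable_next_one_pre _ _ mW).
  have mD : measurable (S (next_cdf p i m) `\` S (next_cdf p i m.-1)).
    exact: measurableD.
  by apply/eqP; rewrite eq_le; apply/andP; split; apply: le_measure_ae => //;
    apply: filterS (ae_beta_one (bW j)) => w /H [].
have sub : S (next_cdf p i m.-1) `<=` S (next_cdf p i m).
  move=> w [w01 wc]; split=> //; apply: (le_trans wc).
  by apply: next_cdf_homo => //; exact: leq_pred.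
rewrite measureD//; last by apply: (le_lt_trans (probability_le1 P' (mS _))); rewrite ltry.
rewrite (setIidr sub) EFinB.
exact: (congr2 (fun a b => (a - b)%E) (GS m) (GS m.-1)).
Qed.

Lemma measurable_path_event s : measurable (path_event s).
Proof.
by apply: bigcap_measurableType => j _; exact: (measurable_next_one_pre _ _ mW).
Qed.

Lemma path_event_prob s : (forall j, (0 < nth 1%N s j)%N) ->
  P' (path_event s) = (path_weight p s)%:E.
Proof.
move=> s0; rewrite /path_event iW ?iota_uniq//; last first.
  by move=> j; exact: measurable_next_one.
rewrite /path_weight /index_iota subn0 -prodEFin.
by apply: eq_bigr => j _; rewrite next_one_prob.
Qed.

Lemma position_path_event n (x : nat -> bool) w : (0 < n)%N -> x n.+1 -> x 1%N ->
  path_event (ones_from n 0 x) w ->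
  position p th n (fun i => W i w) = nth 1%N (ones_from n 0 x).
Proof.
move=> n0 xn x1 sw; apply/funext; elim=> [|j IH].
  by rewrite ones_from_head.
rewrite /= IH; have [js|sj] := ltnP j (size (ones_from n 0 x)).-1.
  by apply: sw => /=; rewrite mem_iota.
(* Past the end of the list both sequences are stuck at 1. *)
by rewrite !ones_from_last ?next_one1// leqW.
Qed.

Section pattern.
Context (n : nat).

(** Entry [k] holds the state at time [k.+1]; a finite type of trajectories is needed to index the
    partition. *)
Definition pattern (c : {ffun 'I_n.+1 -> bool}) (k : nat) : bool := c (inord k.-1).

Lemma pattern_ord c (k : 'I_n.+1) : pattern c k.+1 = c k.
Proof. by rewrite /pattern /= inord_val. Qed.

Context d (T : measurableType d) (P : probability T R) (X : nat -> {RV P >-> bool}).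
Hypotheses (hn : (2 <= n)%N) (hX : derangement_process p n X).

Let past_event_pattern c w : past_event X n 0 (pattern c) w <->
  [ffun k : 'I_n.+1 => X k.+1 w] = c.
Proof.
split=> [H|<- k /andP[k0 kn]].
  by apply/ffunP => k; rewrite ffunE H ?pattern_ord//= ltnS.
by rewrite /pattern ffunE inordK ?prednK.
Qed.

Lemma measurable_scaled_cycle_lengths j :
  measurable_fun setT (fun w => scaled_cycle_lengths R n (fun i => X i w) j).
Proof.
move=> _ B mB; rewrite setTI.
pose Z w : {ffun 'I_n.+1 -> bool} := [ffun k : 'I_n.+1 => X k.+1 w].
have -> : (fun w => scaled_cycle_lengths R n (fun i => X i w) j) @^-1` B =
    Z @^-1` [set c | B (scaled_cycle_lengths R n (pattern c) j)].
  apply/seteqP; split => w /=; rewrite (@eq_scaled_cycle_lengths _ _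
    (fun i => X i w) (pattern (Z w)))// => r /andP[r0 rn];
  by have /past_event_pattern := erefl (Z w); apply; rewrite r0.
apply: measurable_countable_fibers => c.
rewrite (_ : Z @^-1` [set c] = past_event X n 0 (pattern c)).
  exact: measurable_past_event.
by apply/seteqP; split => w /past_event_pattern.
Qed.

(** Trajectories of X are matched with path events of W: the masses agree by [derangement_law] and
    [path_event_prob], and on matched atoms both sequences of lengths are read off the same list. *)
Lemma eq_cycle_lengths_law (E : set (nat -> R)) : product_sigma_algebra E ->
  P [set w | E (scaled_cycle_lengths R n (fun i => X i w))] =
  P' [set w | E (position_gaps R n (position p th n (fun i => W i w)))].
Proof.
move=> mE; have n0 : (0 < n)%N by exact: ltnW.
pose valid c := pattern c n.+1 && pattern c 1%N.
(* Trajectories without the forced ones at [n.+1] and 1 are null and are matched with the empty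
   set. *)
pose e' c := if valid c then path_event (ones_from n 0 (pattern c)) else set0.
apply: (@eq_prob_finite_partition _ _ _ _ _ _ _ _
  (fun c => past_event X n 0 (pattern c)) e'
  [set c | E (scaled_cycle_lengths R n (pattern c))]).
- by move=> c; exact: measurable_past_event.
- by move=> c; rewrite /e'; case: ifP => // _; exact: measurable_path_event.
- apply/trivIsetP => c c' _ _ cc'; apply/seteqP; split => // w [].
  by move=> /past_event_pattern h1 /past_event_pattern h2; rewrite -h1 -h2 eqxx in cc'.
- apply/trivIsetP => c c' _ _ cc'; apply/seteqP; split => // w [].
  (* Disjointness: the positions determine the list, which determines the pattern. *)
  rewrite /e'; case: ifP => // /andP[cn c1]; case: ifP => // /andP[cn' c1'].
  move=> /(position_path_event n0 cn c1) h /(position_path_event n0 cn' c1').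
  rewrite h => hh; move/eqP: cc'; apply; apply/ffunP => k.
  rewrite -!pattern_ord; apply: (eq_ones_from n0 c1 c1') => [j|].
    by rewrite hh.
  exact: (ltn_ord k).
- apply/seteqP; split => // w _.
  by exists [ffun k : 'I_n.+1 => X k.+1 w] => //; apply/past_event_pattern.
- move=> c; rewrite (derangement_law hn hX) /e' -/(valid c); case: ifP => [/andP[_ c1]|_].
    rewrite path_event_prob// => j.
    by have := mem_nth_ones_from j n0 c1; rewrite mem_ones_from => /andP[/andP[]].
  by rewrite measure0.
- by move=> c w h; rewrite /= (@eq_scaled_cycle_lengths _ _ _ (pattern c)).
- move=> c w; rewrite /e'; case: ifP => // /andP[cn c1].
  by move=> /(position_path_event n0 cn c1) h /=; rewrite h -scaled_cycle_lengthsE.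
- rewrite -[X in measurable X]setTI.
  apply: (@measurable_fun_seq R _ T'
    (fun j w => position_gaps R n (position p th n (fun i => W i w)) j)) => //.
  by move=> j; exact: measurable_position_gaps.
Qed.

End pattern.
End coupling.

(** * Convergence to the stick-breaking sequence *)

Theorem theorem9 (R : realType) (theta : nat -> R) (p : nat -> R) (th : R)
    (htheta : forall i, (1 <= i)%N -> 0 < theta i)
    (htheta1 : theta 1%N = 1)
    (hp1 : p 1%N = 0) (hp2 : p 2%N = 1)
    (hp : forall i, (3 <= i)%N ->
       p i = (i%:R - 1) / (i%:R - 1 + theta i))
    (d : nat -> measure_display) (T : forall n, measurableType (d n))
    (P : forall n, probability (T n) R)
    (X : forall n, nat -> {RV P n >-> bool})
    (hX : forall n, (2 <= n)%N -> derangement_process p n (X n))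
    (hth : 0 < th) (htheta_lim : theta n @[n --> \oo] --> th)
    (d' : measure_display) (T' : measurableType d') (Q : probability T' R)
    (A : nat -> {RV Q >-> R}) (hA : GEM_distributed th A) :
  converges_in_distribution P
    (fun n w => scaled_cycle_lengths R n (fun i => X n i w))
    Q (fun w j => A j w).
Proof.
move=> f cf [M fM].
have [dW [TW [PW [W [iW bW AW]]]]] := hA.
have mW j : measurable_fun setT (W j) := measurable_funPT (W j).
have p01 := stay_prob_bounds htheta hp2 hp.
pose Y n w := position_gaps R n (position p th n (fun i => W i w)).
have mY n j : measurable_fun setT (fun w => Y n w j).
  exact: measurable_position_gaps.
have mS j : measurable_fun setT (fun w => stick_breaking (fun i => W i w) j).
  apply: measurable_funM => //; apply: measurable_prod => i _.
  exact: measurable_funB.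
have -> : ('E_Q[fun w => f (fun j => A j w)] =
    'E_PW[fun w => f (stick_breaking (fun i => W i w))])%E.
  apply: (expectation_eq_law (A' := fun j w => stick_breaking (fun i => W i w) j)).
  - by move=> j; exact: measurable_funPT.
  - exact: mS.
  - exact: AW.
  - exact: cf.
  - by exists M.
(* On the space of W convergence is almost sure, and the bound [M] dominates. *)
have cvgY : ('E_PW[fun w => f (Y n w)])%E @[n --> \oo] -->
    ('E_PW[fun w => f (stick_breaking (fun i => W i w))])%E.
  have mfY n : measurable_fun setT (fun w => f (Y n w)).
    exact: (measurable_continuous_seq (A := fun j w => Y n w j)).
  have mfS : measurable_fun setT (fun w => f (stick_breaking (fun i => W i w))).
    exact: (measurable_continuous_seq
      (A := fun j w => stick_breaking (fun i => W i w) j)).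
  rewrite unlock.
  have [] := @dominated_convergence _ _ _ PW setT measurableT
    (fun n w => (f (Y n w))%:E)
    (fun w => (f (stick_breaking (fun i => W i w)))%:E) (cst M%:E).
  - by move=> n; exact/measurable_EFinP.
  - exact/measurable_EFinP.
  - have aeW : {ae PW, forall w, forall i, 0 < W i w < 1}.
      apply/ae_foralln => i; exact: (ae_beta_one (bW i)).
    apply: filterS aeW => w w01 _.
    apply: cvg_EFin; first exact: nearW.
    apply: continuous_cvg; first exact: cf.
    apply: position_gaps_cvg => //.
    exact: next_one_cvg htheta_lim.
  - exact: finite_measure_integrable_cst.
  - by apply: aeW => w n _; rewrite lee_fin.
  - by [].
(* For [n >= 2] the coupled sequence has the law of the cycle lengths, so the expectations
   eventually coincide. *)
apply: cvg_trans cvgY; apply: near_eq_cvg; near=> n.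
have n2 : (2 <= n)%N by near: n; exact: nbhs_infty_ge.
apply/esym.
apply: (expectation_eq_law
  (A := fun j w => scaled_cycle_lengths R n (fun i => X n i w) j)
  (A' := fun j w => Y n w j)).
- by move=> j; exact: measurable_scaled_cycle_lengths.
- exact: mY.
- by move=> E mE; apply: (eq_cycle_lengths_law hth p01 iW bW _ (hX n n2)).
- exact: cf.
- by exists M.
Unshelve. all: by end_near. Qed.
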